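(* There exists a constant $\mathfrak c>1$, not depending on $\varepsilon$, $d$ and $T$, such that the following holds. Let $\mathbf X=\mathbf M+\varepsilon$ where $\mathbf M\in\mathcal M_{d,T}(\mathbb R)$ is a deterministic matrix of rank $k$ and the noise $\varepsilon$ satisfies the noise assumption given in the context. Let $\mathcal S\subseteq\mathcal M_{d,T}(\mathbb R)$ be a non-empty set of matrices of rank at most $k$, and let $\widehat{\mathbf M}_{\mathcal S}\in\arg\min_{\mathbf A\in\mathcal S}\|\mathbf A-\mathbf X\|_F^2$. Then for every $\lambda\in(0,1)$ and every $s\in[0,\infty)$, $$\frac{1}{dT}\left\|\widehat{\mathbf M}_{\mathcal S}-\mathbf M\right\|_F^2\leqslant\frac{1+\lambda}{1-\lambda}\cdot\min_{\mathbf A\in\mathcal S}\frac{1}{dT}\left\|\mathbf A-\mathbf M\right\|_F^2+\frac{4\mathfrak c\,\widetilde{\mathfrak K}_\varepsilon\|\Sigma_\varepsilon\|_{\mathrm{op}}}{\lambda(1-\lambda)}\cdot\frac{k(d+T+s)}{dT}$$ with probability larger than $1-2e^{-s}$.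
   Context: $d\geqslant 1$, $T\geqslant 2$ and $k\in\{1,\dots,T\}$ are integers. $\mathcal M_{m,n}(\mathbb R)$ is the set of real $m\times n$ matrices. $\|\mathbf A\|_F=\mathrm{trace}(\mathbf A\mathbf A^* )^{1/2}$ is the Frobenius norm and $\|\mathbf A\|_{\mathrm{op}}=\sup_{\|x\|=1}\|\mathbf Ax\|$ the operator norm associated with the Euclidean norm. Noise assumption: $\varepsilon$ is a random $d\times T$ real matrix whose rows are independent and have the same $T$-dimensional sub-Gaussian distribution, with second moment matrix $\Sigma_\varepsilon=\mathbb E(\varepsilon_{1,\cdot}^*\varepsilon_{1,\cdot})$ (invertible), where $\varepsilon_{1,\cdot}$ is the first row. Moreover $\varepsilon_{1,\cdot}\Sigma_\varepsilon^{-1/2}$ is isotropic and has finite sub-Gaussian norm $$\mathfrak K_\varepsilon:=\sup_{\|x\|=1}\ \sup_{p\in[1,\infty)}p^{-1/2}\,\mathbb E\big(|\langle\varepsilon_{1,\cdot}\Sigma_\varepsilon^{-1/2},x\rangle|^p\big)^{1/p}<\infty .$$ Set $\widetilde{\mathfrak K}_\varepsilon:=\max(\mathfrak K_\varepsilon^2,\mathfrak K_\varepsilon^4)$. The argmin defining the estimator is assumed non-empty; the minimum over $\mathcal S$ on the right-hand side is read as an infimum if it is not attained. *)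

(* Defs.v *)
From HB Require Import structures.
From mathcomp Require Import all_boot all_order all_algebra.
From mathcomp Require Import all_classical all_reals all_analysis.

Set Implicit Arguments.
Unset Strict Implicit.
Unset Printing Implicit Defensive.

Import Order.TTheory GRing.Theory Num.Theory.
Import numFieldNormedType.Exports.

Local Open Scope classical_set_scope.
Local Open Scope ring_scope.

(* The library norm on ['M_(m, n)] is the max-norm of the entries, hence the
   separate norms below. *)

Definition eucl_norm (R : realType) (n : nat) (x : 'cV[R]_n) : R :=
  Num.sqrt (\sum_(i < n) x i 0 ^+ 2).

Definition frob_norm (R : realType) (m n : nat) (A : 'M[R]_(m, n)) : R :=
  Num.sqrt (\tr (A *m A^T)).

Definition op_norm (R : realType) (m n : nat) (A : 'M[R]_(m, n)) : R :=
  sup [set eucl_norm (A *m x) | x in [set x : 'cV[R]_n | eucl_norm x = 1]].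

Definition psdmx (R : realType) (n : nat) (A : 'M[R]_n) : Prop :=
  A^T = A /\ forall x : 'cV[R]_n, 0 <= (x^T *m A *m x) 0 0.

(* A positive semidefinite matrix has a unique positive semidefinite square
   root; the default value 0 is only used when there is none. *)
Definition sqrtmx (R : realType) (n : nat) (A : 'M[R]_n) : 'M[R]_n :=
  xget 0 [set B : 'M[R]_n | psdmx B /\ B *m B = A].

Definition argmin (R : realType) (E : Type) (S : set E) (f : E -> R) : set E :=
  [set a | S a /\ forall b, S b -> f a <= f b].

Section Probability.
Context (disp : measure_display) (Om : measurableType disp) (R : realType).
Variable P : probability Om R.

(* The event [A] is not required to be measurable: it has to contain a
   measurable event of probability larger than [a]. For a measurable [A] this
   is [a%:E < P A]. *)
Definition with_probability_gt (a : R) (A : set Om) : Prop :=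
  exists E : set Om, [/\ measurable E, E `<=` A & (a%:E < P E)%E].

Definition mutually_independent (I : finType) (disp' : measure_display)
    (E : measurableType disp') (X : I -> Om -> E) : Prop :=
  forall (J : {set I}) (B : I -> set E),
    (forall i, i \in J -> measurable (B i)) ->
    P (\bigcap_(i in [set` J]) (X i @^-1` B i)) =
    (\prod_(i in J) P (X i @^-1` B i))%E.

Definition identically_distributed (I : Type) (disp' : measure_display)
    (E : measurableType disp') (X : I -> Om -> E) : Prop :=
  forall (i j : I) (B : set E), measurable B ->
    P (X i @^-1` B) = P (X j @^-1` B).

Definition second_moment (n : nat) (Y : Om -> 'rV[R]_n) : 'M[R]_n :=
  \matrix_(i, j) fine 'E_P[fun w => Y w 0 i * Y w 0 j].

Definition isotropic (n : nat) (Y : Om -> 'rV[R]_n) : Prop :=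
  second_moment Y = 1%:M.

Definition psi2_norm (Y : Om -> R) : \bar R :=
  ereal_sup [set ((p `^ (- 2^-1))%:E *
                  'E_P[fun w => (`|Y w| `^ p)%R] `^ (p^-1))%E
            | p in `[1%R, +oo[%classic].

Definition subgaussian_norm (n : nat) (Y : Om -> 'rV[R]_n) : \bar R :=
  ereal_sup [set psi2_norm (fun w => (Y w *m x) 0 0)
            | x in [set x : 'cV[R]_n | eucl_norm x = 1]].

Definition subgaussian (n : nat) (Y : Om -> 'rV[R]_n) : Prop :=
  forall x : 'cV[R]_n, (psi2_norm (fun w => (Y w *m x) 0%R 0%R) < +oo)%E.

Section Noise.
Variables (d T : nat) (d_gt0 : (0 < d)%N) (eps : Om -> 'M[R]_(d, T)).

(* Tuples carry the product (Borel) sigma-algebra of R^T. *)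
Definition row_tuple (i : 'I_d) (w : Om) : T.-tuple R :=
  [tuple eps w i j | j < T].

Definition first_row (w : Om) : 'rV[R]_T := row (Ordinal d_gt0) (eps w).

Definition Sigma_eps : 'M[R]_T := second_moment first_row.

Definition normalized_first_row (w : Om) : 'rV[R]_T :=
  first_row w *m sqrtmx (invmx Sigma_eps).

Record noise_assumption : Prop := NoiseAssumption {
  noise_measurable : forall i j, measurable_fun [set: Om] (fun w => eps w i j);
  noise_independent : mutually_independent row_tuple;
  noise_identical : identically_distributed row_tuple;
  noise_subgaussian : subgaussian first_row;
  noise_invertible : Sigma_eps \in unitmx;
  noise_isotropic : isotropic normalized_first_row;
  noise_finite : (subgaussian_norm normalized_first_row < +oo)%E }.

Definition K_eps : R := fine (subgaussian_norm normalized_first_row).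

Definition Ktilde_eps : R := Num.max (K_eps ^+ 2) (K_eps ^+ 4).

End Noise.
End Probability.

(* Main.v *)
Require Import Defs.
From mathcomp Require Import all_boot all_order all_algebra.
From mathcomp Require Import all_classical all_reals all_analysis.
From mathcomp Require Import measurable_realfun.
From mathcomp Require Import ring lra.

(* The minimality of [Mhat] gives |Mhat - M|^2 <= |A - M|^2 + 2 <eps, Mhat - A>
   for [A] in [S]. As [Mhat - A] has rank at most 2k, [eps] may be replaced in
   the scalar product by its compression to a 2k-dimensional space, whose
   squared Frobenius norm is at most 2k |eps|_op^2; Young's inequality with
   weight lambda concludes, provided |eps|_op^2 = O(K^2 |Sigma|_op (d + T + s)).

   For the latter, a point y of the unit ball is fixed. The moment bounds and
   Markov's inequality give P(<eps_i, y>^2 >= 64 kappa n) <= 32^-n with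
   kappa = K^2 |Sigma|_op. If |eps y|^2 is large, there are integers n_i of sum
   m with <eps_i, y>^2 >= 64 kappa n_i for all i, which by independence has
   probability at most 32^-m for each of the at most 2^(m+d) choices of (n_i).
   A union bound over a 1/2-net of at most 16^T points of the unit ball follows.
   The net is a cubic lattice of mesh 1 / (2 sqrt T), and both counts come from
   the same generating function argument. *)

Set Implicit Arguments.
Unset Strict Implicit.
Unset Printing Implicit Defensive.

Import Order.TTheory GRing.Theory Num.Theory.
Import numFieldNormedType.Exports.
Local Open Scope classical_set_scope.
Local Open Scope ring_scope.

(** * Frobenius scalar product and low rank matrices *)

Section FrobeniusForm.
Context {R : realType}.

Definition frob_dot (m n : nat) (A B : 'M[R]_(m, n)) : R := \tr (A *m B^T).

Lemma frob_dotE m n (A B : 'M[R]_(m, n)) :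
  frob_dot A B = \sum_i \sum_j A i j * B i j.
Proof.
by apply: eq_bigr => i _; rewrite mxE; apply: eq_bigr => j _; rewrite mxE.
Qed.

Lemma frob_dotC m n (A B : 'M[R]_(m, n)) : frob_dot A B = frob_dot B A.
Proof. by rewrite /frob_dot -mxtrace_tr trmx_mul trmxK. Qed.

Lemma frob_dotDl m n (A B C : 'M[R]_(m, n)) :
  frob_dot (A + B) C = frob_dot A C + frob_dot B C.
Proof. by rewrite /frob_dot mulmxDl mxtraceD. Qed.

Lemma frob_dotZl m n a (A B : 'M[R]_(m, n)) :
  frob_dot (a *: A) B = a * frob_dot A B.
Proof. by rewrite /frob_dot -scalemxAl mxtraceZ. Qed.

Lemma frob_dotNl m n (A B : 'M[R]_(m, n)) : frob_dot (- A) B = - frob_dot A B.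
Proof. by rewrite -scaleN1r frob_dotZl mulN1r. Qed.

Lemma frob_dotBl m n (A B C : 'M[R]_(m, n)) :
  frob_dot (A - B) C = frob_dot A C - frob_dot B C.
Proof. by rewrite frob_dotDl frob_dotNl. Qed.

Lemma frob_dotBr m n (A B C : 'M[R]_(m, n)) :
  frob_dot C (A - B) = frob_dot C A - frob_dot C B.
Proof. by rewrite !(frob_dotC C) frob_dotBl. Qed.

Lemma frob_dotDr m n (A B C : 'M[R]_(m, n)) :
  frob_dot C (A + B) = frob_dot C A + frob_dot C B.
Proof. by rewrite !(frob_dotC C) frob_dotDl. Qed.

Lemma frob_dotZr m n a (A B : 'M[R]_(m, n)) :
  frob_dot A (a *: B) = a * frob_dot A B.
Proof. by rewrite !(frob_dotC A) frob_dotZl. Qed.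

Lemma frob_sqE m n (A : 'M[R]_(m, n)) :
  frob_dot A A = \sum_i \sum_j A i j ^+ 2.
Proof. by rewrite frob_dotE; under eq_bigr do under eq_bigr do rewrite -expr2. Qed.

Lemma frob_sq_ge0 m n (A : 'M[R]_(m, n)) : 0 <= frob_dot A A.
Proof.
rewrite frob_sqE sumr_ge0 // => i _.
by rewrite sumr_ge0 // => j _; rewrite sqr_ge0.
Qed.

Lemma frob_sq_cV n (x : 'cV[R]_n) : frob_dot x x = \sum_i x i 0 ^+ 2.
Proof. by rewrite frob_sqE; apply: eq_bigr => i _; rewrite big_ord1. Qed.

Lemma frob_sq_eq0 m n (A : 'M[R]_(m, n)) : frob_dot A A = 0 -> A = 0.
Proof.
rewrite frob_sqE => A0; apply/matrixP => i j; rewrite mxE.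
move/eqP: A0; rewrite psumr_eq0 => [|k _]; last first.
  by rewrite sumr_ge0 // => l _; rewrite sqr_ge0.
move=> /allP/(_ i); rewrite mem_index_enum => /(_ isT) /=.
rewrite psumr_eq0 => [|l _]; last exact: sqr_ge0.
move=> /allP/(_ j); rewrite mem_index_enum => /(_ isT) /=.
by rewrite sqrf_eq0 => /eqP.
Qed.

Lemma frob_normK m n (A : 'M[R]_(m, n)) : frob_norm A ^+ 2 = frob_dot A A.
Proof. by rewrite sqr_sqrtr //; exact: frob_sq_ge0. Qed.

Lemma eucl_normK n (x : 'cV[R]_n) : eucl_norm x ^+ 2 = frob_dot x x.
Proof.
by rewrite frob_sq_cV sqr_sqrtr // sumr_ge0 // => i _; rewrite sqr_ge0.
Qed.

Lemma frob_sqB m n (A B : 'M[R]_(m, n)) :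
  frob_dot (A - B) (A - B) = frob_dot A A - 2 * frob_dot A B + frob_dot B B.
Proof. by rewrite frob_dotBl !frob_dotBr (frob_dotC B A); ring. Qed.

Lemma frob_sqZ m n a (A : 'M[R]_(m, n)) :
  frob_dot (a *: A) (a *: A) = a ^+ 2 * frob_dot A A.
Proof. by rewrite frob_dotZl frob_dotZr mulrA. Qed.

Lemma frob_dot_young m n (A B : 'M[R]_(m, n)) (l : R) : 0 < l ->
  2 * frob_dot A B <= l^-1 * frob_dot A A + l * frob_dot B B.
Proof.
move=> l0; have := frob_sq_ge0 (A - l *: B).
rewrite frob_sqB frob_sqZ frob_dotZr => h.
rewrite -(ler_pM2l l0) mulrDr mulVKf ?gt_eqF//; nra.
Qed.

Lemma frob_sqD_le m n (A B : 'M[R]_(m, n)) :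
  frob_dot (A + B) (A + B) <= 2 * frob_dot A A + 2 * frob_dot B B.
Proof.
have := frob_sq_ge0 (A - B); rewrite frob_sqB frob_dotDl !frob_dotDr.
by rewrite (frob_dotC B A); lra.
Qed.

Lemma frob_sq_mulmx m n p (A : 'M[R]_(m, n)) (B : 'M[R]_(n, p)) :
  frob_dot (A *m B) (A *m B) =
  \sum_j frob_dot (A *m col j B) (A *m col j B).
Proof.
rewrite frob_sqE exchange_big /=; apply: eq_bigr => j _.
rewrite frob_sq_cV; apply: eq_bigr => i _; rewrite !mxE; congr (_ ^+ 2).
by apply: eq_bigr => k _; rewrite mxE.
Qed.

(** If [v *m D *m D^T = 0], then [|v *m D|^2 = 0], and [v = 0] because the rows of [D] are
    independent. *)
Lemma gram_unitmx m n (D : 'M[R]_(m, n)) : row_free D -> D *m D^T \in unitmx.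
Proof.
move=> Dfree; rewrite -row_free_unit -kermx_eq0; apply/eqP/row_matrixP => i.
rewrite row0; set v := row i _.
have : v *m (D *m D^T) = 0 by rewrite -row_mul mulmx_ker row0.
move=> /(congr1 (mulmx^~ v^T)); rewrite mul0mx -!mulmxA -trmx_mul mulmxA.
move=> /(congr1 mxtrace); rewrite mxtrace0 => /frob_sq_eq0 vD0.
by apply: (row_free_inj Dfree); rewrite vD0 mul0mx.
Qed.

(* The orthogonal projector onto the row space of [B] replaces a singular value
   decomposition. *)
Lemma row_space_projector m n (B : 'M[R]_(m, n)) :
  exists Q : 'M[R]_n,
    [/\ Q^T = Q, B *m Q = B & frob_dot Q Q = (\rank B)%:R].
Proof.
have [D [C [/gram_unitmx Du BE]]] :
    exists (D : 'M[R]_(\rank B, n)) (C : 'M[R]_(m, \rank B)),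
      row_free D /\ B = C *m D.
  exists (row_base B), (col_base B).
  by split; [exact: row_base_free | rewrite mulmx_base].
pose Q := D^T *m invmx (D *m D^T) *m D.
have QT : Q^T = Q.
  by rewrite /Q !trmx_mul trmx_inv trmx_mul trmxK !mulmxA.
have DQ : D *m Q = D by rewrite /Q !mulmxA mulmxV // mul1mx.
exists Q; split => //.
  by rewrite {1}BE -mulmxA DQ -BE.
rewrite /frob_dot QT {1}/Q -mulmxA DQ -mulmxA mxtrace_mulC -mulmxA mulVmx //.
by rewrite mxtrace1.
Qed.

(** For the projector [Q] onto the row space of [B], [<E, B> = <E *m Q, B>]. The hypothesis applies
    to each column of [Q], and the squared norms of these columns add up to [\rank B]. *)
Lemma frob_dot_low_rank m n (E B : 'M[R]_(m, n)) (b : R) :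
  (forall x : 'cV_n, frob_dot (E *m x) (E *m x) <= b * frob_dot x x) ->
  exists F : 'M[R]_(m, n), frob_dot E B = frob_dot F B /\
    frob_dot F F <= b * (\rank B)%:R.
Proof.
move=> Eb; have [Q [QT BQ Qrk]] := row_space_projector B.
exists (E *m Q); split.
  by rewrite /frob_dot -mulmxA -[in RHS]QT -trmx_mul BQ.
rewrite frob_sq_mulmx (le_trans (ler_sum _ (fun j _ => Eb (col j Q)))) //.
rewrite -mulr_sumr -Qrk; have := frob_sq_mulmx 1%:M Q; rewrite mul1mx => ->.
by under [in leRHS]eq_bigr do rewrite !mul1mx.
Qed.

(** Young's inequality with weight [lambda] is applied twice to [2 <F, h - a>], once to [h] and once
    to [a]. Each use costs [|F|^2 / lambda], at most [2 k b / lambda], which explains the factor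
    4. *)
Lemma low_rank_least_squares m n (k : nat) (E M A H : 'M[R]_(m, n))
    (b lambda : R) : 0 < lambda < 1 -> 0 <= b ->
  (forall x : 'cV_n, frob_dot (E *m x) (E *m x) <= b * frob_dot x x) ->
  (\rank A <= k)%N -> (\rank H <= k)%N ->
  frob_dot (H - (M + E)) (H - (M + E)) <=
    frob_dot (A - (M + E)) (A - (M + E)) ->
  (1 - lambda) * frob_dot (H - M) (H - M) <=
    (1 + lambda) * frob_dot (A - M) (A - M) + 4 * k%:R * b / lambda.
Proof.
move=> /andP[l0 l1] b0 Eb rkA rkH.
have rkB : (\rank (H - A)%R <= k + k)%N.
  by rewrite (leq_trans (mxrank_add _ _)) // mxrank_opp leq_add.
have [F [EF Fb]] := frob_dot_low_rank (H - A) Eb.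
have {}Fb : frob_dot F F <= 2 * k%:R * b.
  rewrite (le_trans Fb) // mulrC ler_wpM2r //.
  by rewrite -natrM ler_nat mul2n -addnn.
rewrite !opprD !addrA !(frob_sqB (_ - M)).
set a := A - M; set h := H - M.
move: EF; have -> : H - A = h - a by rewrite /a /h opprB subrKA.
move: a h => a h; rewrite !frob_dotBr !(frob_dotC _ E) => EF.
have := frob_dot_young F h l0.
have := frob_dot_young (- F) a l0.
rewrite !frob_dotNl (frob_dotC F (- F)) frob_dotNl opprK => ha hh hle.
have : lambda^-1 * frob_dot F F <= lambda^-1 * (2 * k%:R * b).
  by rewrite ler_wpM2l // invr_ge0 ltW.
have -> : 4 * k%:R * b / lambda = 2 * (lambda^-1 * (2 * k%:R * b)) by ring.
lra.
Qed.

End FrobeniusForm.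

(** * Counting integer vectors *)

Section Counting.
Context {R : realType}.

Lemma sum_ffun_prod (I A : finType) (a : A -> R) :
  \sum_(f : {ffun I -> A}) \prod_i a (f i) = (\sum_x a x) ^+ #|I|.
Proof. by rewrite -(bigA_distr_bigA (fun _ => a)) prodr_const. Qed.

Lemma sum_half_powers_le n : \sum_(j < n) (2^-1 : R) ^+ j <= 2.
Proof.
suff -> : \sum_(j < n) (2^-1 : R) ^+ j = 2 - 2 * 2^-1 ^+ n.
  by rewrite gerBl mulr_ge0 // exprn_ge0.
elim: n => [|n IHn]; first by rewrite big_ord0 expr0; lra.
by rewrite big_ord_recr /= IHn exprS; lra.
Qed.

(** This evaluates a generating function at 1/2: the product of [2^N] and all [2^-h (f i)] is at
    least 1 for each counted [f], and its sum over all [f] factorizes over [I]. *)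
Lemma card_ffun_weight_le (I A : finType) (h : A -> nat) (N : nat) (c : R) :
  \sum_a 2^-1 ^+ h a <= c ->
  #|[set f : {ffun I -> A} | (\sum_i h (f i) <= N)%N]%SET|%:R <=
    2 ^+ N * c ^+ #|I|.
Proof.
move=> hc; rewrite -sum1_card natr_sum.
have step (f : {ffun I -> A}) : (\sum_i h (f i) <= N)%N ->
    (1 : R) <= 2 ^+ N * \prod_i 2^-1 ^+ h (f i).
  move=> fN; rewrite -expr_sum -(subnK fN) exprD -mulrA -exprMn.
  by rewrite mulfV ?pnatr_eq0 // expr1n mulr1 exprn_ege1 // ler1n.
apply: (@le_trans _ _ (\sum_(f : {ffun I -> A})
    2 ^+ N * \prod_i 2^-1 ^+ h (f i))).
  rewrite big_mkcond ler_sum // => f _; rewrite inE.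
  case: ifPn => [/step//|_].
  by rewrite mulr_ge0 ?exprn_ge0 ?prodr_ge0 // => i _; rewrite exprn_ge0.
rewrite -mulr_sumr (sum_ffun_prod _ (fun a => 2^-1 ^+ h a)).
by rewrite ler_wpM2l ?exprn_ge0 // lerXn2r // nnegrE ?(le_trans _ hc) // sumr_ge0.
Qed.

(** Units are added one by one: while the total is below that of [N], some coordinate can still
    grow. *)
Lemma exists_composition (I : finType) (N : I -> nat) (m : nat) :
  (m <= \sum_i N i)%N ->
  exists f : {ffun I -> 'I_m.+1},
    (\sum_i f i)%N = m /\ forall i, (f i <= N i)%N.
Proof.
(* No value exceeds the total [m], so [inord] preserves all of them. *)
move=> mN; suff [g [gm gN]] : exists g : I -> nat,
    (\sum_i g i)%N = m /\ forall i, (g i <= N i)%N.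
  have gE i : (inord (g i) : 'I_m.+1) = g i :> nat.
    by rewrite inordK // ltnS -gm (bigD1 i) //= leq_addr.
  exists [ffun i => inord (g i)]; split => [|i]; last by rewrite ffunE gE.
  by rewrite -[RHS]gm; apply: eq_bigr => i _; rewrite ffunE gE.
elim: m mN => [_|m IHm mN]; first by exists (fun _ => 0%N); rewrite big1.
have [g [gm gN]] := IHm (ltnW mN).
have [i gi] : exists i, (g i < N i)%N.
  apply/existsP; apply: contraLR mN; rewrite negb_exists => /forallP Ng.
  by rewrite -leqNgt -gm leq_sum // => i _; rewrite leqNgt.
exists (fun j => (g j + (j == i))%N); split; last first.
  by move=> j; case: eqP => [->|_]; rewrite ?addn1 ?addn0.
by rewrite big_split /= gm -big_mkcond big_pred1_eq addn1.
Qed.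

End Counting.

(** * Operator norm and nets *)

Section OperatorNorm.
Context {R : realType}.

Lemma frob_sq_mulmx_homogeneous m n (A : 'M[R]_(m, n)) (b : R) :
  (forall x : 'cV_n, frob_dot x x = 1 -> frob_dot (A *m x) (A *m x) <= b) ->
  forall x : 'cV_n, frob_dot (A *m x) (A *m x) <= b * frob_dot x x.
Proof.
move=> Ab x; have [x0|] := eqVneq (frob_dot x x) 0.
  by rewrite (frob_sq_eq0 x0) mulmx0 !frob_dotE !big1 ?mulr0// => i _;
     rewrite big1 // => j _; rewrite !mxE mul0r.
move=> xn0; have x0 : 0 < frob_dot x x by rewrite lt_def xn0 frob_sq_ge0.
have := Ab ((Num.sqrt (frob_dot x x))^-1 *: x).
rewrite -scalemxAr !frob_sqZ exprVn sqr_sqrtr ?(ltW x0) // mulVf // => /(_ erefl).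
by rewrite mulrC ler_pdivrMr.
Qed.

(** The [sup] in [op_norm] is meaningful only for a bounded set. The bound holds because the
    coordinates of a unit vector are at most 1 in absolute value. *)
Lemma op_norm_has_ubound m n (A : 'M[R]_(m, n)) :
  has_ubound [set eucl_norm (A *m x) | x in [set x : 'cV[R]_n | eucl_norm x = 1]].
Proof.
exists (Num.sqrt (\sum_i (\sum_j `|A i j|) ^+ 2)) => _ [x /= x1 <-].
apply: ler_wsqrtr; apply: ler_sum => i _.
rewrite -real_normK ?num_real // lerXn2r ?nnegrE ?sumr_ge0 //.
rewrite mxE (le_trans (ler_norm_sum _ _ _)) // ler_sum // => j _.
rewrite normrM ler_piMr //.
rewrite -(@ler_pXn2r _ 2) ?nnegrE // expr1n real_normK ?num_real //.
rewrite -(expr1n _ 2) -x1 eucl_normK frob_sq_cV (bigD1 j) //=.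
by rewrite lerDl sumr_ge0 // => k _; rewrite sqr_ge0.
Qed.

Lemma op_norm_ge0 m n (A : 'M[R]_(m, n)) : 0 <= op_norm A.
Proof.
rewrite /op_norm; set S := [set _ | _ in _].
(* For [n = 0] there is no unit vector, and the supremum of the empty set is 0. *)
have [->|/set0P[y Sy]] := eqVneq S set0; first by rewrite sup0.
apply: (@le_trans _ _ y); first by case: Sy => x _ <-; exact: sqrtr_ge0.
by apply: ub_le_sup => //; exact: op_norm_has_ubound.
Qed.

Lemma frob_sq_op_norm m n (A : 'M[R]_(m, n)) (x : 'cV[R]_n) :
  frob_dot (A *m x) (A *m x) <= op_norm A ^+ 2 * frob_dot x x.
Proof.
move: x; apply: frob_sq_mulmx_homogeneous => x x1.
rewrite -eucl_normK lerXn2r ?nnegrE ?sqrtr_ge0 ?op_norm_ge0 //.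
apply: ub_le_sup; first exact: op_norm_has_ubound.
exists x => //=; apply/eqP.
by rewrite -(@eqrXn2 _ 2) ?sqrtr_ge0 // eucl_normK x1 expr1n.
Qed.

Lemma op_norm_sq_le m n (A : 'M[R]_(m, n)) (b : R) : (0 < n)%N -> 0 <= b ->
  (forall x : 'cV_n, frob_dot x x = 1 -> frob_dot (A *m x) (A *m x) <= b) ->
  op_norm A ^+ 2 <= b.
Proof.
move=> n0 b0 Ab; rewrite -(sqr_sqrtr b0) lerXn2r ?nnegrE ?op_norm_ge0 ?sqrtr_ge0 //.
apply: ge_sup => [|_ [x /= x1 <-]]; last first.
  rewrite -[leLHS]ger0_norm ?sqrtr_ge0 // -sqrtr_sqr eucl_normK.
  by rewrite ler_wsqrtr // Ab // -eucl_normK x1 expr1n.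
pose e : 'cV[R]_n := delta_mx (Ordinal n0) 0.
exists (eucl_norm (A *m e)), e => //=.
rewrite /eucl_norm (bigD1 (Ordinal n0)) //= big1 => [|i ni].
  by rewrite mxE !eqxx expr1n addr0 sqrtr1.
by rewrite mxE (negbTE ni) expr0n.
Qed.

(** Young's inequality with weight [op_norm A] stands in for Cauchy-Schwarz: both of its terms are
    at most [op_norm A * |x|^2]. *)
Lemma quad_form_op_norm n (A : 'M[R]_n) (x : 'cV[R]_n) : 0 < op_norm A ->
  frob_dot x (A *m x) <= op_norm A * frob_dot x x.
Proof.
move=> A0; have := frob_dot_young (A *m x) x A0.
have := frob_sq_op_norm A x.
rewrite -(ler_pM2l (_ : 0 < (op_norm A)^-1)) ?invr_gt0 //.
rewrite mulrA expr2 mulKf ?gt_eqF // frob_dotC; lra.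
Qed.

Lemma op_norm_gt0 n (A : 'M[R]_n) : (0 < n)%N -> A \in unitmx -> 0 < op_norm A.
Proof.
move=> n0 Au; rewrite lt_def op_norm_ge0 andbT; apply/eqP => A0.
pose e : 'cV[R]_n := delta_mx (Ordinal n0) 0.
have := frob_sq_op_norm A (invmx A *m e).
rewrite A0 expr0n mul0r mulmxA mulmxV // mul1mx frob_sq_cV.
rewrite (bigD1 (Ordinal n0)) //= mxE !eqxx expr1n => h.
by have : \sum_(i < n | i != Ordinal n0) e i 0 ^+ 2 >= 0;
  [rewrite sumr_ge0 // => i _; rewrite sqr_ge0 | lra].
Qed.

(* A coordinate is encoded by its sign and its magnitude, in units of the mesh
   [1 / (2 sqrt n)]. *)
Definition lattice_point n (f : {ffun 'I_n -> bool * 'I_(n + n).+1}) : 'cV[R]_n :=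
  \col_i ((-1) ^+ (f i).1 * (f i).2%:R / (2 * Num.sqrt n%:R)).

(** A bound on the sum of the magnitudes is what the generating function can count. The points may
    leave the unit ball, so the norm condition is stated separately below. *)
Definition lattice_net n : {set {ffun 'I_n -> bool * 'I_(n + n).+1}} :=
  [set f : {ffun 'I_n -> bool * 'I_(n + n).+1} | (\sum_i (f i).2 <= n + n)%N]%SET.

(** Two signs and a geometric series give weight at most 4 per coordinate, whence
    [2^(2n) * 4^n = 16^n]. *)
Lemma card_lattice_net_le n : #|lattice_net n|%:R <= (16 : R) ^+ n.
Proof.
apply: (@le_trans _ _ (2 ^+ (n + n) * 4 ^+ #|'I_n|)).
  apply: (@card_ffun_weight_le R 'I_n (bool * 'I_(n + n).+1)%type
    (fun a => a.2 : nat) (n + n) 4).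
  rewrite -(pair_bigA _ (fun (b : bool) (j : 'I_(n + n).+1) => 2^-1 ^+ j)) /=.
  by rewrite big_bool /=; have := @sum_half_powers_le R (n + n).+1; lra.
rewrite card_ord addnn -mul2n exprM -exprMn_comm; last exact: mulrC.
by have -> : 2 ^+ 2 * 4 = 16 :> R by ring.
Qed.

(** Each coordinate is rounded towards 0. This does not increase the norm, and the [n] errors, each
    at most the mesh, have squares of sum at most [n / (4n)]. *)
Lemma lattice_net_approx n (x : 'cV[R]_n) : (0 < n)%N -> frob_dot x x = 1 ->
  exists2 f, f \in lattice_net n &
    frob_dot (lattice_point f) (lattice_point f) <= 1 /\
    frob_dot (x - lattice_point f) (x - lattice_point f) <= 4^-1.
Proof.
move=> n0 x1.
have [r rE] : exists r : R, r = 2 * Num.sqrt n%:R by exists (2 * Num.sqrt n%:R).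
have r0 : 0 < r by rewrite rE mulr_gt0 // sqrtr_gt0 ltr0n.
have r2 : r ^+ 2 = 4 * n%:R by rewrite rE exprMn sqr_sqrtr //; ring.
pose t i := Num.truncn (r * `|x i 0|).
have tP i : (t i)%:R <= r * `|x i 0| < (t i)%:R + 1.
  by rewrite natr1; apply: truncn_itv; rewrite mulr_ge0 // ltW.
have sumt : (\sum_i t i <= n + n)%N.
  rewrite -(@ler_nat R) natr_sum.
  (* The bound [r |x_i| <= 1 + n x_i^2] is [(2 - r |x_i|)^2 >= 0] expanded; its sum over [i] is the
     budget [2n]. *)
  apply: (@le_trans _ _ (\sum_i (1 + n%:R * x i 0 ^+ 2))).
    apply: ler_sum => i _; have /andP[ti _] := tP i; apply: (le_trans ti).
    have : 0 <= (2 * 1 - r * `|x i 0|) ^+ 2 by exact: sqr_ge0.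
    by rewrite sqrrB !exprMn r2 real_normK ?num_real //; lra.
  by rewrite big_split /= -mulr_sumr -frob_sq_cV x1 sumr_const card_ord mulr1 natrD.
have tE i : (inord (t i) : 'I_(n + n).+1) = t i :> nat.
  by rewrite inordK // ltnS (leq_trans _ sumt) // (bigD1 i) //= leq_addr.
pose f := [ffun i => (x i 0 < 0, inord (t i) : 'I_(n + n).+1)].
have xE i : x i 0 = (-1) ^+ (x i 0 < 0)%R * `|x i 0|.
  exact: numEsign.
have fE i : lattice_point f i 0 = (-1) ^+ (x i 0 < 0)%R * ((t i)%:R / r).
  by rewrite mxE !ffunE /= tE mulrA -rE.
exists f; first by rewrite inE; under eq_bigr do rewrite ffunE /= tE.
split; rewrite frob_sq_cV.
  rewrite -x1 frob_sq_cV; apply: ler_sum => i _.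
  rewrite fE exprMn sqrr_sign mul1r -[leRHS]real_normK ?num_real //.
  rewrite lerXn2r ?nnegrE //.
    by rewrite divr_ge0 // ltW.
  by rewrite ler_pdivrMr // mulrC; have /andP[] := tP i.
apply: (@le_trans _ _ (\sum_(i < n) (r^-1) ^+ 2)); last first.
  rewrite sumr_const card_ord exprVn r2 -[X in X <= _]mulr_natr invfM -mulrA.
  rewrite mulVf ?mulr1 //.
  by rewrite pnatr_eq0 -lt0n.
apply: ler_sum => i _.
rewrite mxE [X in _ + X]mxE fE {1}xE -mulrBr exprMn sqrr_sign mul1r.
have -> : `|x i 0| - (t i)%:R / r = (r * `|x i 0| - (t i)%:R) / r.
  by field; rewrite gt_eqF.
have /andP[h1 h2] := tP i.
rewrite lerXn2r ?nnegrE ?invr_ge0 ?(ltW r0) //.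
  by rewrite divr_ge0 ?subr_ge0 // ltW.
by rewrite ler_piMl ?invr_ge0 ?(ltW r0) //; lra.
Qed.

(** A unit vector is within 1/2 of a net point of the unit ball, so [|A|^2 <= 2 b + |A|^2 / 2] for
    the operator norm, and the last term is absorbed. *)
Lemma frob_sq_mulmx_net m n (A : 'M[R]_(m, n)) (b : R) : (0 < n)%N -> 0 <= b ->
  (forall f, f \in lattice_net n ->
    frob_dot (lattice_point f) (lattice_point f) <= 1 ->
    frob_dot (A *m lattice_point f) (A *m lattice_point f) <= b) ->
  forall x : 'cV_n, frob_dot (A *m x) (A *m x) <= 4 * b * frob_dot x x.
Proof.
move=> n0 b0 Ab x; apply: (le_trans (frob_sq_op_norm _ _)).
rewrite ler_wpM2r ?frob_sq_ge0 //.
suff : op_norm A ^+ 2 <= 2 * b + 2^-1 * op_norm A ^+ 2 by lra.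
apply: op_norm_sq_le => // [|{}x x1].
  by have := sqr_ge0 (op_norm A); lra.
have [f fN [y1 xy]] := lattice_net_approx n0 x1.
rewrite -[x in A *m x](subrK (lattice_point f)) addrC mulmxDr.
apply: (le_trans (frob_sqD_le _ _)).
have := frob_sq_op_norm A (x - lattice_point f).
have := Ab f fN y1; have := ler_wpM2l (sqr_ge0 (op_norm A)) xy; lra.
Qed.

End OperatorNorm.

(** * Tail bounds *)

Section Tails.
Context {disp : measure_display} {Om : measurableType disp} {R : realType}.
Context (P : probability Om R).

Lemma prob_bigcup_le (I : finType) (Q : {set I}) (A : I -> set Om) (c : R) :
  (forall i, i \in Q -> measurable (A i)) ->
  (forall i, i \in Q -> (P (A i) <= c%:E)%E) ->
  (P (\bigcup_(i in [set` Q]) A i) <= (#|Q|%:R * c)%:E)%E.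
Proof.
move=> mA Ac; rewrite cardE.
have -> : [set` Q] = [set` enum Q] by apply/seteqP; split => i /=; rewrite mem_enum.
rewrite bigcup_seq; have : {subset enum Q <= Q} by move=> i; rewrite mem_enum.
elim: (enum Q) => [_|i s IHs sQ]; first by rewrite big_nil measure0 mul0r.
have iQ : i \in Q by apply: sQ; rewrite mem_head.
have {}sQ : {subset s <= Q} by move=> j js; apply: sQ; rewrite inE js orbT.
rewrite big_cons /= -natr1 mulrDl mul1r addrC EFinD.
rewrite (le_trans (measureU2 _ _ _)) ?leeD ?Ac ?IHs //.
  exact: mA.
by rewrite -bigcup_seq; apply: fin_bigcup_measurable => // j /sQ; exact: mA.
Qed.

(** The supremum over [p] is used at [p = 2n] only, where real powers turn into natural ones. *)
Lemma psi2_norm_moment (Y : Om -> R) (K : R) (n : nat) : (0 < n)%N -> 0 <= K ->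
  (psi2_norm P Y <= K%:E)%E ->
  ('E_P[fun w => (`|Y w| ^+ (2 * n)%N)%R] <= (((2 * n)%:R * K ^+ 2) ^+ n)%:E)%E.
Proof.
move=> n0 K0 YK; pose p : R := (2 * n)%:R.
have p1 : 1 <= p by rewrite ler1n muln_gt0.
have p0 : 0 < p by apply: lt_le_trans p1.
pose E := ('E_P[fun w => (`|Y w| `^ p)%R])%E.
have E0 : (0 <= E)%E by apply: expectation_ge0 => w; exact: powR_ge0.
have EK : (E `^ p^-1 <= (K * p `^ 2^-1)%:E)%E.
  have : ((p `^ (- 2^-1))%:E * E `^ p^-1 <= K%:E)%E.
    apply: le_trans YK; apply: ereal_sup_ubound.
    by exists p => //=; rewrite in_itv /= p1.
  rewrite powRN lee_pdivrMl ?powR_gt0 //.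
  by rewrite -EFinM mulrC.
have -> : ('E_P[fun w => (`|Y w| ^+ (2 * n)%N)%R])%E = E.
  by rewrite /E; congr expectation; apply/funext => w; rewrite powR_mulrn.
have -> : E = ((E `^ p^-1) `^ p)%E by rewrite -poweRrM mulVf ?gt_eqF // poweRe1.
have -> : ((2 * n)%:R * K ^+ 2) ^+ n = (K * p `^ 2^-1) `^ p.
  rewrite powR_mulrn ?mulr_ge0 ?powR_ge0 // exprM; congr (_ ^+ n).
  rewrite exprMn mulrC; congr (_ * _).
  by rewrite -powR_mulrn ?powR_ge0 // -powRrM mulVf // powRr1 // ltW.
rewrite -poweR_EFin; apply: gt0_ler_poweR => //.
  by rewrite in_itv /= poweR_ge0 leey.
by rewrite in_itv /= lee_fin mulr_ge0 ?powR_ge0 // leey.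
Qed.

(** Markov's inequality at order [2n] gives the ratio of [(2 n K^2)^n] to [(64 K^2 n)^n]. The
    constant 64 makes this [32^-n], small enough to beat the later counts. *)
Lemma psi2_norm_tail (Y : Om -> R) (K : R) (n : nat) :
  measurable_fun [set: Om] Y -> 0 < K -> (psi2_norm P Y <= K%:E)%E ->
  (P [set w | (64 * K ^+ 2 * n%:R <= Y w ^+ 2)%R] <= (32^-1 ^+ n)%:E)%E.
Proof.
move=> mY K0 YK; set c := 64 * K ^+ 2 * n%:R.
have mS : measurable [set w | c <= Y w ^+ 2].
  rewrite -[X in measurable X]setTI; apply: measurable_fun_le => //.
  exact: measurable_funX.
have [n00|n0] := posnP n; first by rewrite n00 expr0; exact: probability_le1.
have K20 : 0 < K ^+ 2 by rewrite exprn_gt0.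
have c0 : 0 < c by rewrite !mulr_gt0 ?ltr0n.
pose X : {RV P >-> R} := mfun_Sub (mem_set mY).
have := @markov _ _ _ P X (fun x => x ^+ (2 * n)) (Num.sqrt c).
rewrite sqrtr_gt0 exprM sqr_sqrtr ?(ltW c0) // => /(_ c0).
move=> /(_ (exprn_measurable _) (exprn_ge0 _)).
have -> : [set x | ((Num.sqrt c)%:E <= `|(X x)%:E|)%E] = [set w | c <= Y w ^+ 2].
  apply/seteqP; split => w /=;
  by rewrite lee_fin -sqrtr_sqr ler_sqrt // sqr_ge0.
move=> mk.
have {mk} := le_trans (mk _) (psi2_norm_moment n0 (ltW K0) YK).
rewrite -lee_pdivlMl ?exprn_gt0 // => /(_ _)/le_trans; apply.
  by move=> x y x0 y0 xy; rewrite lerXn2r.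
rewrite -EFinM lee_fin -exprVn -exprMn le_eqVlt; apply/orP; left; apply/eqP.
congr (_ ^+ n); rewrite natrM /c; field.
by rewrite pnatr_eq0 -lt0n n0 gt_eqF.
Qed.

End Tails.

(** * Operator norm of the noise *)

Section NoiseBounds.
Context {R : realType}.

Lemma frob_dot_mulmxl m n p (A : 'M[R]_(p, m)) (x : 'M[R]_(m, n)) y :
  frob_dot (A *m x) y = frob_dot x (A^T *m y).
Proof. by rewrite /frob_dot trmx_mul trmxK mulmxA -mulmxA mxtrace_mulC. Qed.

Context {disp : measure_display} {Om : measurableType disp}.
Context (P : probability Om R) (d T : nat) (d_gt0 : (0 < d)%N).
Context (eps : Om -> 'M[R]_(d, T)) (T_gt0 : (0 < T)%N).
Context (noise : noise_assumption P d_gt0 eps).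

Local Notation Sigma := (Sigma_eps P d_gt0 eps).
Local Notation K := (K_eps P d_gt0 eps).
Local Notation Z := (normalized_first_row P d_gt0 eps).

Lemma tr_Sigma_eps : Sigma^T = Sigma.
Proof.
apply/matrixP => i j; rewrite !mxE; congr (fine (expectation _ _)).
by apply/funext => w; rewrite mulrC.
Qed.

(* The default value of [sqrtmx] is excluded because it would make [Z] vanish,
   against isotropy. *)
Lemma normalized_row_factor : exists U : 'M[R]_T,
  [/\ forall w, first_row d_gt0 eps w = Z w *m U,
      forall x : 'cV_T, frob_dot (U *m x) (U *m x) <= op_norm Sigma * frob_dot x x &
      0 < op_norm Sigma].
Proof.
have S0 := op_norm_gt0 T_gt0 (noise_invertible noise).
have := noise_isotropic noise; rewrite /isotropic /normalized_first_row /sqrtmx.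
case: xgetP => [Q _ [[QT _] QQ] _|_]; last first.
  move=> /matrixP/(_ (Ordinal T_gt0) (Ordinal T_gt0)); rewrite !mxE eqxx.
  under [X in expectation _ X]funext => w do rewrite mulmx0 mxE mul0r.
  by rewrite expectation_cst /= => /esym/eqP; rewrite oner_eq0.
have QS : Q *m (Q *m Sigma) = 1%:M.
  by rewrite mulmxA QQ mulVmx // (noise_invertible noise).
(* As [Q] is an inverse square root of [Sigma], [U = Q *m Sigma] acts as a square root: [Q *m U = 1]
   and [U^T *m U = Sigma]. *)
exists (Q *m Sigma); split => [w|x|//].
  by rewrite -mulmxA QS mulmx1.
rewrite frob_dot_mulmxl mulmxA trmx_mul QT tr_Sigma_eps -(mulmxA _ Q) QS mulmx1.
exact: quad_form_op_norm.
Qed.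

Lemma psi2_norm_normalized (u : 'cV[R]_T) : frob_dot u u = 1 ->
  (psi2_norm P (fun w => (Z w *m u) 0%R 0%R) <= subgaussian_norm P Z)%E.
Proof.
move=> u1; apply: ereal_sup_ubound; exists u => //=.
by apply/eqP; rewrite -(@eqrXn2 _ 2) ?sqrtr_ge0 // eucl_normK u1 expr1n.
Qed.

(** By isotropy a coordinate of [Z] has second moment 1, so [p = 2] bounds the norm below by
    [2^(-1/2)]. As the norm is finite, [fine] loses nothing. *)
Lemma subgaussian_norm_K_eps : 0 < K /\ subgaussian_norm P Z = K%:E.
Proof.
pose i0 := Ordinal T_gt0; pose e : 'cV[R]_T := delta_mx i0 0.
have e1 : frob_dot e e = 1.
  rewrite frob_sq_cV (bigD1 i0) //= big1 => [|i ni].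
    by rewrite mxE !eqxx expr1n addr0.
  by rewrite mxE (negbTE ni) expr0n.
have : ((2 `^ (- 2^-1))%:E <= subgaussian_norm P Z)%E.
  apply: le_trans (psi2_norm_normalized e1); apply: ereal_sup_ubound.
  exists 2; first by rewrite /= in_itv /= ler1n.
  have -> : ('E_P[fun w => (`|(Z w *m e) 0 0| `^ 2)%R])%E = 1%:E.
    have := noise_isotropic noise.
    move=> /matrixP/(_ i0 i0); rewrite !mxE eqxx.
    have -> : (fun w => Z w 0 i0 * Z w 0 i0) = (fun w => `|(Z w *m e) 0 0| `^ 2).
      apply/funext => w; rewrite powR_mulrn // real_normK ?num_real // expr2.
      rewrite [(_ *m e) _ _]mxE (bigD1 i0) //= big1 => [|i ni].
        by rewrite [e _ _]mxE !eqxx mulr1 addr0.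
      by rewrite [e _ _]mxE (negbTE ni) mulr0.
    (* An infinite expectation would have [fine] equal to 0, but isotropy makes it 1. *)
    case: ('E_P[_])%E => [r /= ->//| |] /= /eqP; by rewrite eq_sym oner_eq0.
  by rewrite poweR_EFin powR1 mule1.
have := noise_finite noise; rewrite /K_eps.
case: (subgaussian_norm P Z) => [r _ | |] //=.
by rewrite lee_fin => a; split => //; apply: lt_le_trans a; rewrite powR_gt0.
Qed.

Lemma measurable_eps_mulmx (y : 'cV[R]_T) i :
  measurable_fun [set: Om] (fun w => (eps w *m y) i 0).
Proof.
under eq_fun do rewrite mxE.
apply: measurable_sum => j; apply: measurable_funM => //.
exact: (noise_measurable noise).
Qed.

(** Since the first row is [Z *m U], its product with [y] is that of [Z] with [U *m y], of squared
    length at most [op_norm Sigma]. Scaling [U *m y] to length 1 reduces to the scalar tail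
    bound. *)
Lemma first_row_tail (y : 'cV[R]_T) (n : nat) : frob_dot y y <= 1 ->
  (P [set w | (64 * (K ^+ 2 * op_norm Sigma) * n%:R <=
      (eps w *m y) (Ordinal d_gt0) 0 ^+ 2)%R] <= (32^-1 ^+ n)%:E)%E.
Proof.
move=> y1; have [U [ZU US S0]] := normalized_row_factor.
have [K0 KE] := subgaussian_norm_K_eps.
have epsE w : (eps w *m y) (Ordinal d_gt0) 0 = (Z w *m (U *m y)) 0 0.
  by rewrite mulmxA -ZU /first_row -row_mul [RHS]mxE.
set A := [set w | _]; have mA : measurable A.
  rewrite -[A]setTI; apply: measurable_fun_le => //.
  exact/measurable_funX/measurable_eps_mulmx.
have [n00|n0] := posnP n; first by rewrite n00 expr0; exact: probability_le1.
have {}US : frob_dot (U *m y) (U *m y) <= op_norm Sigma.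
  by apply: (le_trans (US y)); rewrite ler_piMr // ltW.
(* If [U *m y = 0], the event is empty, the threshold being positive for [n > 0]. *)
have [u0|un0] := eqVneq (frob_dot (U *m y) (U *m y)) 0.
  rewrite [A](_ : _ = set0) ?measure0 ?lee_fin ?exprn_ge0 //.
  apply/seteqP; split => w //=; rewrite /A /= epsE (frob_sq_eq0 u0) mulmx0 mxE.
  by rewrite expr0n leNgt !mulr_gt0 ?exprn_gt0 ?ltr0n.
pose a := Num.sqrt (frob_dot (U *m y) (U *m y)).
have a0 : 0 < a by rewrite sqrtr_gt0 lt_def un0 frob_sq_ge0.
have a2 : a ^+ 2 = frob_dot (U *m y) (U *m y) by rewrite sqr_sqrtr ?frob_sq_ge0.
have u1 : frob_dot (a^-1 *: (U *m y)) (a^-1 *: (U *m y)) = 1.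
  by rewrite frob_sqZ -a2 exprVn mulVf // sqrf_eq0 gt_eqF.
pose Y w := (Z w *m (a^-1 *: (U *m y))) 0 0.
have YE w : (eps w *m y) (Ordinal d_gt0) 0 = a * Y w.
  by rewrite epsE /Y -scalemxAr [in RHS]mxE mulVKf // gt_eqF.
have mY : measurable_fun [set: Om] Y.
  have -> : Y = fun w => a^-1 * (eps w *m y) (Ordinal d_gt0) 0.
    by apply/funext => w; rewrite YE mulKf // gt_eqF.
  by apply: measurable_funM => //; exact: measurable_eps_mulmx.
have YK : (psi2_norm P Y <= K%:E)%E by rewrite -KE; exact: psi2_norm_normalized.
apply: le_trans (psi2_norm_tail n mY K0 YK).
apply: le_measure; rewrite ?inE //.
  rewrite -[X in measurable X]setTI; apply: measurable_fun_le => //.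
  exact: measurable_funX.
move=> w; rewrite /A /= YE exprMn => h.
have a20 : 0 < a ^+ 2 by rewrite exprn_gt0.
rewrite -(ler_pM2l a20); apply: le_trans h.
have -> : 64 * (K ^+ 2 * op_norm Sigma) * n%:R =
  op_norm Sigma * (64 * K ^+ 2 * n%:R) by ring.
by rewrite ler_wpM2r ?a2 // mulr_ge0 // mulr_ge0 // sqr_ge0.
Qed.

(** Each row event is the preimage of a measurable set of tuples under [row_tuple]. Independence
    gives the product, and equality of the distributions brings every factor to the first row. *)
Lemma prob_bigcap_row_tails (y : 'cV[R]_T) (c : 'I_d -> R) :
  P (\bigcap_i [set w | (c i <= (eps w *m y) i 0 ^+ 2)%R])
  = (\prod_i P [set w | (c i <= (eps w *m y) (Ordinal d_gt0) 0 ^+ 2)%R])%E.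
Proof.
pose B r := [set t : T.-tuple R | r <= (\sum_j tnth t j * y j 0) ^+ 2].
have mB r : measurable (B r).
  rewrite -[B r]setTI; apply: measurable_fun_le => //.
  apply: measurable_funX; apply: measurable_sum => j; apply: measurable_funM => //.
  exact: measurable_tnth.
have BE r i : [set w | r <= (eps w *m y) i 0 ^+ 2] = row_tuple eps i @^-1` B r.
  rewrite /B /preimage; apply/funext => w /=; congr (is_true (_ <= _ ^+ 2)).
  by rewrite mxE; apply: eq_bigr => j _; rewrite tnth_mktuple.
have := noise_independent noise (J := [set: 'I_d]%SET) (B := fun i => B (c i)).
have -> : [set` [set: 'I_d]%SET] = setT.
  by apply/seteqP; split => i //= _; rewrite inE.
under eq_bigcapr do rewrite -BE.
move=> -> //; apply: eq_big => [i|i _]; first by rewrite inE.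
by rewrite BE; apply: (noise_identical noise).
Qed.

Local Notation kappa := (K ^+ 2 * op_norm Sigma).

(* If [N i] is the integer part of [(eps w *m y) i 0 ^+ 2 / (64 * kappa)] and
   [m <= \sum_i N i], then some [f <= N] sums to exactly [m]; so [m] is only
   reached on a finite union of intersections of row events. *)
Lemma frob_sq_eps_mulmx_tail (y : 'cV[R]_T) (m : nat) : frob_dot y y <= 1 ->
  exists B : set Om, [/\ measurable B, (P B <= (2 ^+ d * 16^-1 ^+ m)%:E)%E &
    forall w, ~ B w ->
      frob_dot (eps w *m y) (eps w *m y) <= 64 * kappa * (m + d)%:R].
Proof.
move=> y1; have [_ [_ _ S0]] := normalized_row_factor.
have [K0 _] := subgaussian_norm_K_eps.
have k0 : 0 < 64 * kappa by rewrite !mulr_gt0 ?exprn_gt0.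
pose row_event (r : R) i := [set w | r <= (eps w *m y) i 0 ^+ 2].
have mE r i : measurable (row_event r i).
  rewrite -[row_event r i]setTI; apply: measurable_fun_le => //.
  by apply: measurable_funX; exact: measurable_eps_mulmx.
pose Q := [set f : {ffun 'I_d -> 'I_m.+1} | (\sum_i f i == m)%N]%SET.
pose A (f : {ffun 'I_d -> 'I_m.+1}) := \bigcap_i row_event (64 * kappa * (f i)%:R) i.
have mA f : measurable (A f).
  by apply: fin_bigcap_measurable => [|i _]; [exact: finite_finset | exact: mE].
have cardQ : #|Q|%:R <= 2 ^+ m * 2 ^+ d :> R.
  pose Q' := [set f : {ffun 'I_d -> 'I_m.+1} | (\sum_i f i <= m)%N]%SET.
  apply: (@le_trans _ _ #|Q'|%:R).
    rewrite ler_nat subset_leq_card //.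
    by apply/fintype.subsetP => f; rewrite !inE => /eqP->.
  have := @card_ffun_weight_le R 'I_d 'I_m.+1 (fun j => j : nat) m 2
    (sum_half_powers_le _).
  by rewrite card_ord.
exists (\bigcup_(f in [set` Q]) A f); split.
- by apply: fin_bigcup_measurable => //.
- apply: le_trans (prob_bigcup_le (c := 32^-1 ^+ m) _ _) _ => // [f|].
    rewrite inE => /eqP fm; rewrite prob_bigcap_row_tails.
    apply: (@le_trans _ _ (\prod_i (32^-1 ^+ f i)%:E)%E).
      set a := (X in (_ <= X)%E); set b := (X in (X <= _)%E).
      (* Nonnegativity is carried through the induction because multiplying the inequalities
         requires it. *)
      suff /andP[_ //] : (0 <= b <= a)%E.
      rewrite /a /b; elim/big_ind2 : _ => [|u1 u2 v1 v2|i _].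
      - by rewrite lee01 lexx.
      - move=> /andP[u0 u12] /andP[v0 v12].
        by rewrite mule_ge0 //= lee_pmul.
      - by rewrite measure_ge0 /= first_row_tail.
    by rewrite prodEFin -expr_sum fm.
  rewrite lee_fin.
  (* The count contributes [2^m * 2^d], and each composition [32^-m]. *)
  have -> : 2 ^+ d * 16^-1 ^+ m = 2 ^+ m * 2 ^+ d * 32^-1 ^+ m :> R.
    rewrite [RHS]mulrAC [RHS]mulrC -[in RHS]exprMn; congr (_ * _ ^+ _).
    by field.
  by rewrite ler_wpM2r // exprn_ge0.
- move=> w Bw.
  pose N i := Num.truncn ((eps w *m y) i 0 ^+ 2 / (64 * kappa)).
  have Nle i : (N i)%:R <= (eps w *m y) i 0 ^+ 2 / (64 * kappa) < (N i)%:R + 1.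
    by rewrite natr1; apply: truncn_itv; rewrite divr_ge0 ?sqr_ge0 // ltW.
  have Nm : (\sum_i N i <= m)%N.
    rewrite leqNgt; apply/negP => /ltnW mN; apply: Bw.
    have [f [fm fN]] := exists_composition mN.
    exists f; first by rewrite /= inE fm.
    move=> i _; rewrite /row_event /=.
    have /andP[Ni _] := Nle i.
    rewrite mulrC -ler_pdivlMr //; apply: le_trans Ni.
    by rewrite ler_nat.
  rewrite frob_sq_cV.
  (* Taking integer parts loses at most one unit per row, hence [m + d]. *)
  apply: (@le_trans _ _ (\sum_(i < d) 64 * kappa * ((N i)%:R + 1))).
    apply: ler_sum => i _; rewrite mulrC -ler_pdivrMr //.
    by have /andP[_ /ltW] := Nle i.
  rewrite -mulr_sumr ler_pM2l // big_split /= sumr_const card_ord -natr_sum natrD.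
  by rewrite lerD2r ler_nat.
Qed.

Lemma op_norm_eps_tail (s : R) : 0 <= s ->
  exists B : set Om, [/\ measurable B, (P B <= (expR (- s))%:E)%E &
    forall w, ~ B w -> forall x : 'cV_T,
      frob_dot (eps w *m x) (eps w *m x) <=
        512 * kappa * (d%:R + T%:R + s) * frob_dot x x].
Proof.
move=> s0; have [_ [_ _ S0]] := normalized_row_factor.
have [K0 _] := subgaussian_norm_K_eps.
have k0 : 0 < kappa by rewrite mulr_gt0 ?exprn_gt0.
(* The part [d + T] of the exponent pays for the factor [2^d] and the [16^T] net points; the rest
   leaves [16^-(truncn s + 1)], at most [e^-s]. *)
pose m := (d + T + (Num.truncn s).+1)%N.
have /andP[ts st] := truncn_itv s0.
pose Q := [set f in lattice_net T |
  frob_dot (@lattice_point R T f) (lattice_point f) <= 1]%SET.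
have /choice[B BP] : forall f, exists B : set Om, f \in Q ->
    [/\ measurable B, (P B <= (2 ^+ d * 16^-1 ^+ m)%:E)%E &
    forall w, ~ B w ->
      frob_dot (eps w *m lattice_point f) (eps w *m lattice_point f) <=
        64 * kappa * (m + d)%:R].
  move=> f; have [fQ|nfQ] := boolP (f \in Q); last by exists set0.
  have := fQ; rewrite inE => /andP[_ /(frob_sq_eps_mulmx_tail m)[B BP]].
  by exists B.
exists (\bigcup_(f in [set` Q]) B f); split.
- by apply: fin_bigcup_measurable => // f /BP[].
- apply: le_trans (prob_bigcup_le (c := 2 ^+ d * 16^-1 ^+ m) _ _) _;
    [by move=> f /BP[] | by move=> f /BP[] |].
  rewrite lee_fin.
  have cardQ : #|Q|%:R <= 16 ^+ T :> R.
    apply: le_trans (card_lattice_net_le T); rewrite ler_nat subset_leq_card //.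
    by apply/fintype.subsetP => f; rewrite inE => /andP[].
  apply: (@le_trans _ _ (16 ^+ T * (16 ^+ d * 16^-1 ^+ m))).
    apply: ler_pM => //.
    by rewrite ler_wpM2r ?exprn_ge0 // lerXn2r ?nnegrE // ler_nat.
  have -> : 16 ^+ T * (16 ^+ d * 16^-1 ^+ m) = 16^-1 ^+ (Num.truncn s).+1 :> R.
    rewrite /m !exprD !exprVn; field.
    by rewrite !expf_neq0 ?pnatr_eq0.
  (* Here [e^(-1/2) >= 1 - 1/2] is squared. *)
  have e4 : 4^-1 <= expR (-1) :> R.
    have -> : -1 = - 2^-1 + - 2^-1 :> R by field.
    rewrite expRD; have := @expR_ge1Dx R (- 2^-1); nra.
  have -> : - s = (Num.truncn s).+1%:R * (-1) + ((Num.truncn s).+1%:R - s) by ring.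
  rewrite expRD expRM_natl.
  rewrite -[leLHS]mulr1; apply: ler_pM; rewrite ?exprn_ge0 //.
    by rewrite lerXn2r ?nnegrE ?expR_ge0 //; apply: le_trans e4; lra.
  by apply: le_trans (expR_ge1Dx _); rewrite lerDl subr_ge0 ltW.
- move=> w Bw x.
  apply: le_trans (frob_sq_mulmx_net (b := 64 * kappa * (m + d)%:R) T_gt0 _ _ x) _.
  + by rewrite mulr_ge0 // mulr_ge0 // ltW.
  + move=> f fN f1.
    have fQ : f \in Q by rewrite inE fN.
    by have [_ _] := BP f fQ; apply => Bf; apply: Bw; exists f.
  + rewrite ler_wpM2r ?frob_sq_ge0 //.
    (* The factor 4 comes from the net, 64 from the tail bound and 2 from [m + d <= 2 (d + T + s)],
       where [T >= 1] absorbs the unit added to [truncn s]. *)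
    have -> : 512 * kappa * (d%:R + T%:R + s) =
      4 * (64 * kappa * (2 * (d%:R + T%:R + s))) by ring.
    rewrite !ler_pM2l ?mulr_gt0 //.
    have : (1 : R) <= T%:R by rewrite ler1n.
    by rewrite /m !natrD -natr1; lra.
Qed.

End NoiseBounds.

Theorem theorem3p2 (R : realType) :
  exists c : R, 1 < c /\
  forall (d T k : nat) (d_gt0 : (0 < d)%N),
  (2 <= T)%N -> (1 <= k <= T)%N ->
  forall (disp : measure_display) (Om : measurableType disp)
    (P : probability Om R) (eps : Om -> 'M[R]_(d, T)),
  noise_assumption P d_gt0 eps ->
  forall (M : 'M[R]_(d, T)) (X : Om -> 'M[R]_(d, T)),
  \rank M = k ->
  (forall w, X w = M + eps w) ->
  forall (S : set 'M[R]_(d, T)),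
  S !=set0 ->
  (forall A, S A -> (\rank A <= k)%N) ->
  forall (Mhat : Om -> 'M[R]_(d, T)),
  (forall w, argmin S (fun A => frob_norm (A - X w) ^+ 2) (Mhat w)) ->
  forall lambda s : R, 0 < lambda < 1 -> 0 <= s ->
  with_probability_gt P (1 - 2 * expR (- s))
    [set w |
      (d * T)%:R^-1 * frob_norm (Mhat w - M) ^+ 2 <=
      (1 + lambda) / (1 - lambda) *
        inf [set (d * T)%:R^-1 * frob_norm (A - M) ^+ 2 | A in S] +
      4 * c * Ktilde_eps P d_gt0 eps * op_norm (Sigma_eps P d_gt0 eps) /
        (lambda * (1 - lambda)) *
        (k%:R * (d%:R + T%:R + s) / (d * T)%:R)].
Proof.
exists 512; split; first by rewrite ltr1n.
move=> d T k d_gt0 T2 /andP[k1 kT] disp Om P eps noise M X rkM XE S S0 Srk Mhat.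
move=> Mhat_min lambda s lambda01 s0; have T_gt0 : (0 < T)%N by apply: leq_trans T2.
have [B [mB PB EB]] := op_norm_eps_tail T_gt0 noise s0.
(* Off [B] the operator norm of the noise is controlled, and the rest of the argument is
   deterministic. *)
exists (~` B); split; first exact: measurableC.
- move=> w /= /(EB w) {}EB; have [SMhat minMhat] := Mhat_min w.
  have /andP[l0 l1] := lambda01.
  set K := K_eps P d_gt0 eps in EB; set Kt := Ktilde_eps P d_gt0 eps.
  set L := op_norm _ in EB *.
  have L0 : 0 <= L by exact: op_norm_ge0.
  have KKt : K ^+ 2 <= Kt by rewrite /Kt /Ktilde_eps le_max lexx.
  have D0 : 0 <= d%:R + T%:R + s :> R by rewrite !addr_ge0.
  have dT0 : 0 < (d * T)%:R :> R by rewrite ltr0n muln_gt0 d_gt0.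
  have l10 : 0 < 1 - lambda by rewrite subr_gt0.
  set b := 512 * Kt * L * (d%:R + T%:R + s).
  have b0 : 0 <= b.
    apply: mulr_ge0 D0; apply: mulr_ge0 L0; apply: mulr_ge0; first exact: ler0n.
    exact: le_trans (sqr_ge0 K) KKt.
  have {}EB (x : 'cV_T) : frob_dot (eps w *m x) (eps w *m x) <= b * frob_dot x x.
    apply: (le_trans (EB x)); rewrite ler_wpM2r ?frob_sq_ge0 // /b mulrA.
    apply: ler_wpM2r D0 _ _ _; apply: ler_wpM2r L0 _ _ _.
    by apply: ler_wpM2l KKt; exact: ler0n.
  set err := (X in _ <= _ + X).
  have errE : err = (d * T)%:R^-1 * (4 * k%:R * b / lambda) / (1 - lambda).
    by rewrite /err /b; field; rewrite !gt_eqF // ltr0n.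
  set r := (1 + lambda) / (1 - lambda).
  have r0 : 0 < r by rewrite divr_gt0 // addr_gt0.
  rewrite -lerBlDr -ler_pdivrMl //; apply: lb_le_inf => [|_ [A SA <-]].
    by case: S0 => A SA; exists ((d * T)%:R^-1 * frob_norm (A - M) ^+ 2), A.
  rewrite ler_pdivrMl // lerBlDr errE !frob_normK.
  have := minMhat A SA; rewrite !frob_normK XE => hle.
  have := low_rank_least_squares lambda01 b0 EB (Srk _ SA) (Srk _ SMhat) hle.
  have dTV : 0 <= (d * T)%:R^-1 :> R by rewrite invr_ge0 ltW.
  move=> /(ler_wpM2l dTV) h; rewrite -(ler_pM2r l10); move: h.
  set a := frob_dot (Mhat w - M) _; set c := frob_dot (A - M) _.
  have -> : (r * ((d * T)%:R^-1 * c) +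
      (d * T)%:R^-1 * (4 * k%:R * b / lambda) / (1 - lambda)) * (1 - lambda) =
    (d * T)%:R^-1 * ((1 + lambda) * c + 4 * k%:R * b / lambda).
    by rewrite /r; field; rewrite !gt_eqF // ltr0n.
  by rewrite -[X in _ -> X <= _]mulrA (mulrC a).
- rewrite probability_setC //.
  (* The complement has probability at least [1 - e^-s]; the factor 2 in the claim makes the
     inequality strict. *)
  apply: (@lt_le_trans _ _ (1 - (expR (- s))%:E)%E); last by rewrite leeB.
  by rewrite -EFinB lte_fin; have := expR_gt0 (- s); lra.
Qed.
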